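(* Let $\Lambda\in\mathbb{R}$ and let $a_0>0$, $\dot a_0\in\mathbb{R}$, $b_0>0$, $\dot b_0\in\mathbb{R}$, $\phi_0\in\mathbb{R}$, $\dot\phi_0>0$, $\rho_0\ge 0$ be initial data satisfying the initial constraint $$\left(\frac{\dot b_0}{b_0}\right)^2+2\frac{\dot a_0}{a_0}\frac{\dot b_0}{b_0}-\Lambda=8\pi\rho_0+4\pi\dot\phi_0^{\,2}.$$ If $\Lambda\ge 0$ and $\dot b_0>0$, then the Einstein-scalar field system on the Bianchi type I space-time with these initial data has a global solution, i.e. there exists a solution $(a,b,\rho,\phi)$ defined on all of $[0,+\infty)$.
   Context: Setting: the Bianchi type I space-time is $\mathbb{R}^4$ with metric $g=-dt^2+a(t)^2(dx^1)^2+b(t)^2[(dx^2)^2+(dx^3)^2]$, where $a>0$, $b>0$ are unknown functions of $t$. The unknown $\rho=\rho(t)\ge 0$ is the density of a co-moving pure-radiation perfect fluid, $\phi=\phi(t)$ is a real scalar field, and $\Lambda$ is the cosmological constant. An overdot denotes $d/dt$. In this setting the Einstein-scalar field system with cosmological constant $\Lambda$ is the following system of ordinary differential equations: the Hamiltonian constraint $$\left(\frac{\dot b}{b}\right)^2+2\frac{\dot a}{a}\frac{\dot b}{b}-\Lambda=8\pi\rho+4\pi\dot\phi^2,$$ and the evolution equations $$\left(\frac{\dot b}{b}\right)^2+2\frac{\ddot b}{b}-\Lambda=-\frac{8\pi\rho}{3}-4\pi\dot\phi^2,$$ $$\frac{\ddot a}{a}+\frac{\dot a\dot b}{ab}+\frac{\ddot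 b}{b}-\Lambda=-\frac{8\pi\rho}{3}-4\pi\dot\phi^2,$$ $$\ddot\phi\,\dot\phi+\left(\frac{\dot a}{a}+2\frac{\dot b}{b}\right)\dot\phi^2=0,$$ $$\dot\rho+\frac43\left(\frac{\dot a}{a}+2\frac{\dot b}{b}\right)\rho=0.$$ A solution on $[0,T)$, $0<T\le+\infty$, with initial data $(a_0,\dot a_0,b_0,\dot b_0,\phi_0,\dot\phi_0,\rho_0)$ is a quadruple $(a,b,\rho,\phi)$ of real functions on $[0,T)$ with $a,b,\phi$ of class $C^2$, $\rho$ of class $C^1$, $a>0$, $b>0$, $\rho\ge0$, $\dot\phi\ge 0$ (the scalar field is sought non-decreasing), satisfying all the equations above on $[0,T)$ and $a(0)=a_0$, $\dot a(0)=\dot a_0$, $b(0)=b_0$, $\dot b(0)=\dot b_0$, $\phi(0)=\phi_0$, $\dot\phi(0)=\dot\phi_0$, $\rho(0)=\rho_0$. Global means $T=+\infty$. *)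

(* Defs.v *)
From Stdlib Require Import Reals.
From Coquelicot Require Import Coquelicot.
Open Scope R_scope.

Definition time_interval (T : Rbar) (t : R) : Prop :=
  0 <= t /\ Rbar_lt (Finite t) T.

(* Derivatives and continuity are relative to [D] ([D_in], [continue_in]): at the
   left end point 0 of [0,T) they are one-sided, and the values of the functions
   outside [D] are irrelevant. *)
Definition C1_on (D : R -> Prop) (f f' : R -> R) : Prop :=
  (forall t, D t -> D_in f f' D t) /\ (forall t, D t -> continue_in f' D t).

Definition C2_on (D : R -> Prop) (f f' f'' : R -> R) : Prop :=
  (forall t, D t -> D_in f f' D t) /\ C1_on D f' f''.

(* Here and below [da], [dda], ... are the values of the first and second time
   derivatives of [a], ... *)
Definition hamiltonian_constraint (Lambda a da b db dphi rho : R) : Prop :=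
  (db / b) ^ 2 + 2 * (da / a) * (db / b) - Lambda
  = 8 * PI * rho + 4 * PI * dphi ^ 2.

Definition evolution_equations
    (Lambda a da dda b db ddb dphi ddphi rho drho : R) : Prop :=
  (db / b) ^ 2 + 2 * (ddb / b) - Lambda
    = - (8 * PI * rho / 3) - 4 * PI * dphi ^ 2
  /\ dda / a + (da * db) / (a * b) + ddb / b - Lambda
    = - (8 * PI * rho / 3) - 4 * PI * dphi ^ 2
  /\ ddphi * dphi + (da / a + 2 * (db / b)) * dphi ^ 2 = 0
  /\ drho + 4 / 3 * (da / a + 2 * (db / b)) * rho = 0.

Definition is_solution (Lambda : R) (T : Rbar)
    (a0 da0 b0 db0 phi0 dphi0 rho0 : R) (a b rho phi : R -> R) : Prop :=
  Rbar_lt (Finite 0) T /\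
  exists da dda db ddb dphi ddphi drho : R -> R,
    C2_on (time_interval T) a da dda /\
    C2_on (time_interval T) b db ddb /\
    C2_on (time_interval T) phi dphi ddphi /\
    C1_on (time_interval T) rho drho /\
    (forall t, time_interval T t ->
       0 < a t /\ 0 < b t /\ 0 <= rho t /\ 0 <= dphi t) /\
    (forall t, time_interval T t ->
       hamiltonian_constraint Lambda (a t) (da t) (b t) (db t) (dphi t) (rho t) /\
       evolution_equations Lambda (a t) (da t) (dda t) (b t) (db t) (ddb t)
         (dphi t) (ddphi t) (rho t) (drho t)) /\
    a 0 = a0 /\ da 0 = da0 /\ b 0 = b0 /\ db 0 = db0 /\
    phi 0 = phi0 /\ dphi 0 = dphi0 /\ rho 0 = rho0.

Definition is_global_solution (Lambda a0 da0 b0 db0 phi0 dphi0 rho0 : R)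
    (a b rho phi : R -> R) : Prop :=
  is_solution Lambda p_infty a0 da0 b0 db0 phi0 dphi0 rho0 a b rho phi.

(* Main.v *)
(** The mean logarithmic expansion [u = ln (a b^2 / (a0 b0^2)) / 3] decouples.
    The shear [(a'/a - b'/b) / 3] and [phi'] scale like [exp (-3 u)] and [rho]
    like [exp (-4 u)], so the Hamiltonian constraint becomes the autonomous
    equation [3 u'^2 = Lambda + 8 PI rho0 exp (-4 u) + m exp (-6 u)] with
    [m > 0].  The hypothesis [db0 > 0] selects the branch [u' > 0]; along it
    [u >= 0], so [u'] is bounded by its initial value and separation of
    variables gives a global [u].  The unknowns are then explicit in [u] and
    [J], the primitive of [exp (-3 u)]. *)

Require Import Defs.
From Stdlib Require Import Reals Lra ClassicalEpsilon.
From Coquelicot Require Import Coquelicot.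
Open Scope R_scope.

(** * Calculus: relative derivatives, primitives and scalar autonomous equations *)

Lemma is_derive_D_in (f f' : R -> R) (D : R -> Prop) (t : R) :
  is_derive f t (f' t) -> D_in f f' D t.
Proof.
  intros H; apply is_derive_Reals in H.
  intros e He; destruct (H e He) as [d Hd].
  exists d; split; [apply cond_pos|].
  intros x [[_ Hx] Hdist]; simpl in *; unfold R_dist in *.
  specialize (Hd (x - t) ltac:(lra) Hdist).
  now replace (t + (x - t)) with x in Hd by ring.
Qed.

Lemma continuous_continue_in (f : R -> R) (D : R -> Prop) (t : R) :
  continuous f t -> continue_in f D t.
Proof.
  intros H; apply continuity_pt_filterlim in H.
  intros e He; destruct (H e He) as [d [Hd Hl]].
  exists d; split; [exact Hd|].
  intros x [[_ Hx] Hdist]; apply Hl; repeat split; auto.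
Qed.

Lemma is_derive_continuous (f : R -> R) (x l : R) :
  is_derive f x l -> continuous f x.
Proof.
  intros Hf; apply (ex_derive_continuous (V := R_NormedModule)); now exists l.
Qed.

(** All functions built below have two-sided derivatives at every [t >= 0], so the one-sided
    conditions at 0 follow by restriction. *)
Lemma is_derive_C1_on (f f' : R -> R) (D : R -> Prop) :
  (forall t, D t -> is_derive f t (f' t)) ->
  (forall t, D t -> continuous f' t) -> C1_on D f f'.
Proof.
  intros H H'; split; intros t Ht.
  - now apply is_derive_D_in, H.
  - now apply continuous_continue_in, H'.
Qed.

Lemma is_derive_C2_on (f f' f'' : R -> R) (D : R -> Prop) :
  (forall t, D t -> is_derive f t (f' t)) ->
  (forall t, D t -> is_derive f' t (f'' t)) ->
  (forall t, D t -> continuous f'' t) -> C2_on D f f' f''.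
Proof.
  intros H H' H''; split.
  - intros t Ht; now apply is_derive_D_in, H.
  - now apply is_derive_C1_on.
Qed.

Lemma is_derive_scal_exp (c : R) (f : R -> R) (t l : R) :
  is_derive f t l -> is_derive (fun s => c * exp (f s)) t (l * (c * exp (f t))).
Proof.
  intros Hf; auto_derive; [now exists l|].
  replace (Derive _ t) with l by (symmetry; now apply is_derive_unique).
  ring.
Qed.

Lemma is_derive_primitive (f : R -> R) (a x : R) :
  (forall y, continuous f y) -> is_derive (fun z => RInt f a z) x (f x).
Proof.
  intros Hf; apply (is_derive_RInt f (fun z => RInt f a z) a); [|apply Hf].
  apply filter_forall; intros y; apply (RInt_correct f a y).
  apply (ex_RInt_continuous (V := R_CompleteNormedModule)); auto.
Qed.

(** Separation of variables: the time [T x] needed to reach [x] is the primitive of [/ g]. Its slope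
    is at least [/ M], so [T] maps onto the real line, and its inverse is the desired [u].
    Continuity of [g] suffices; no Lipschitz condition enters. *)
Lemma bounded_positive_field_flow (g : R -> R) (M : R) :
  (forall x, continuous g x) -> (forall x, 0 < g x <= M) ->
  exists u : R -> R, u 0 = 0 /\ forall t, is_derive u t (g (u t)).
Proof.
  intros Hc Hg.
  assert (HM : 0 < M) by (pose proof (Hg 0); lra).
  pose (T := fun x => RInt (fun y => / g y) 0 x).
  assert (Hci : forall x, continuous (fun y => / g y) x).
  { intros x; apply (continuous_comp g Rinv); [apply Hc|].
    apply (ex_derive_continuous (V := R_NormedModule)).
    pose proof (Hg x); auto_derive; lra. }
  assert (HT : forall x, is_derive T x (/ g x)).
  { intros x; now apply (is_derive_primitive (fun y => / g y)). }
  assert (HT0 : T 0 = 0) by exact (RInt_point 0 _).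
  (* Written without division, this form of the mean value theorem yields surjectivity of [T], the
     value [u 0], and both the Lipschitz bound and the difference quotient of [u]. *)
  assert (Hmvt : forall x y, exists c, Rmin x y <= c <= Rmax x y /\
                   y - x = g c * (T y - T x)).
  { intros x y.
    destruct (MVT_gen T x y (fun z => / g z)) as [c [Hin Heq]].
    - intros; apply HT.
    - intros z _; apply continuity_pt_filterlim.
      eapply is_derive_continuous, HT.
    - exists c; split; [exact Hin|].
      rewrite Heq; pose proof (Hg c); field; lra. }
  assert (Hsurj : forall t, exists x, T x = t).
  { intros t.
    destruct (IVT_gen T (- (M * Rabs t)) (M * Rabs t) t) as [x [_ Hx]].
    - intros z; apply continuity_pt_filterlim.
      eapply is_derive_continuous, HT.
    - set (r := M * Rabs t).
      pose proof (Rabs_pos t) as Hp.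
      assert (Hr : 0 <= r) by (unfold r; nra).
      assert (Hup : Rabs t <= T r).
      { destruct (Hmvt 0 r) as [c [_ E]]; rewrite HT0 in E.
        pose proof (Hg c); unfold r in E at 1.
        assert (0 <= T r) by nra. nra. }
      assert (Hlo : T (- r) <= - Rabs t).
      { destruct (Hmvt (- r) 0) as [c [_ E]]; rewrite HT0 in E.
        pose proof (Hg c); unfold r in E at 1.
        assert (T (- r) <= 0) by nra. nra. }
      pose proof (Rle_abs t); pose proof (Rle_abs (- t)).
      rewrite Rabs_Ropp in *.
      rewrite Rmin_left, Rmax_right by lra; lra.
    - now exists x. }
  pose (u := fun t => proj1_sig (constructive_indefinite_description _ (Hsurj t))).
  assert (Hu : forall t, T (u t) = t)
    by (intros t; exact (proj2_sig (constructive_indefinite_description _ (Hsurj t)))).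
  exists u; split.
  { destruct (Hmvt 0 (u 0)) as [c [_ E]]; rewrite Hu, HT0 in E; lra. }
  intros t; apply is_derive_Reals; intros e He.
  pose proof (Hc (u t)) as Hcu; apply continuity_pt_filterlim in Hcu.
  destruct (Hcu e He) as [d [Hd Hlim]].
  (* [u] is [M]-Lipschitz, so [Rabs h < d / M] keeps the intermediate point [c] within [d] of [u t].
     The difference quotient of [u] is exactly [g c]. *)
  assert (Hdm : 0 < d / M) by (apply Rdiv_lt_0_compat; lra).
  exists (mkposreal _ Hdm); simpl; intros h Hh0 Hh.
  destruct (Hmvt (u t) (u (t + h))) as [c [Hin E]].
  rewrite !Hu in E; replace (t + h - t) with h in E by ring.
  rewrite E; replace (g c * h / h) with (g c) by (field; auto).
  (* The limit in [Hlim] is punctured, hence the separate case [c = u t]. *)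
  destruct (Req_dec (u t) c) as [->|Hne].
  { now rewrite Rminus_diag_eq, Rabs_R0. }
  apply (Hlim c); split; [split; [exact I|auto]|].
  simpl; unfold R_dist.
  assert (Hlip : Rabs (u (t + h) - u t) < d).
  { rewrite E, Rabs_mult; pose proof (Hg c).
    rewrite (Rabs_pos_eq (g c)) by lra.
    assert (M * Rabs h < d).
    { replace d with (M * (d / M)) by (field; lra).
      now apply Rmult_lt_compat_l. }
    pose proof (Rabs_pos h); nra. }
  revert Hin Hlip; unfold Rmin, Rmax.
  destruct (Rle_dec (u t) (u (t + h))); unfold Rabs;
    repeat destruct Rcase_abs; lra.
Qed.

(** * The equation for the mean expansion *)

Section Expansion.

Variables L r m : R.
Hypotheses (HL : 0 <= L) (Hr : 0 <= r) (Hm : 0 < m).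

(** The squared mean Hubble rate at mean scale factor [exp u]: cosmological constant, radiation, and
    scalar field together with shear. *)
Let F (u : R) := L + r * exp (-4 * u) + m * exp (-6 * u).

Lemma expansion_rate_pos (u : R) : 0 < F u.
Proof.
  unfold F; pose proof (exp_pos (-4 * u)); pose proof (exp_pos (-6 * u)).
  assert (0 <= r * exp (-4 * u)) by nra.
  assert (0 < m * exp (-6 * u)) by nra.
  lra.
Qed.

(** The chain rule gives [F' (u) * u' / (2 * sqrt (F u))]; since [u' = sqrt (F u)], the root cancels
    and [F' (u) / 2] remains. *)
Lemma expansion_rate_derive (u : R -> R) (t : R) :
  is_derive u t (sqrt (F (u t))) ->
  is_derive (fun s => sqrt (F (u s))) t
    (- (2 * r * exp (-4 * u t) + 3 * m * exp (-6 * u t))).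
Proof.
  intros Hu; pose proof (expansion_rate_pos (u t)) as Hp.
  pose proof (sqrt_lt_R0 _ Hp) as Hs.
  evar_last.
  - apply (is_derive_comp (fun x => sqrt (F x)) u); [|exact Hu].
    unfold F in *; auto_derive; [exact Hp | reflexivity].
  - unfold scal; simpl; unfold mult; simpl; unfold F in *; field; lra.
Qed.

(** Here [q = sqrt (F u)]. Continuity of [u] is recorded on the whole line because
    [is_derive_primitive], later applied to [exp (-3 u)], asks for an integrand continuous
    everywhere. *)
Lemma expansion_global :
  exists u q : R -> R, u 0 = 0 /\ (forall t, continuous u t) /\
    forall t, 0 <= t ->
      0 < q t /\ q t ^ 2 = F (u t) /\ is_derive u t (q t) /\
      is_derive q t (- (2 * r * exp (-4 * u t) + 3 * m * exp (-6 * u t))).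
Proof.
  assert (HF0 : forall x, 0 <= x -> F x <= F 0).
  { intros x Hx; unfold F.
    assert (forall k, k <= 0 -> exp (k * x) <= exp (k * 0)) as He.
    { intros k Hk; destruct (Req_dec (k * x) (k * 0)) as [->|]; [lra|].
      left; apply exp_increasing; nra. }
    pose proof (He (-4) ltac:(lra)); pose proof (He (-6) ltac:(lra)); nra. }
  (* Freezing the field on [u < 0], where it is unbounded, leaves forward orbits of 0 unchanged. *)
  destruct (bounded_positive_field_flow
              (fun x => sqrt (F (Rmax x 0))) (sqrt (F 0))) as [u [Hu0 Hu]].
  - intros x; apply (continuous_comp (fun x => Rmax x 0) (fun y => sqrt (F y))).
    + apply continuous_ext with (fun y => (y + Rabs y) / 2).
      * intros y; unfold Rmax, Rabs; destruct Rle_dec, Rcase_abs; simpl; lra.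
      * apply (continuous_mult (fun y => y + Rabs y) (fun _ => / 2)).
        -- apply (continuous_plus (fun y => y) Rabs);
             [apply continuous_id | apply continuous_Rabs].
        -- apply continuous_const.
    + apply (ex_derive_continuous (V := R_NormedModule)).
      pose proof (expansion_rate_pos (Rmax x 0)) as Hp; unfold F in *.
      auto_derive; auto 12.
  - intros x; split; [apply sqrt_lt_R0, expansion_rate_pos|].
    apply sqrt_le_1_alt, HF0, Rmax_r.
  - exists u, (fun t => sqrt (F (u t))); split; [exact Hu0|]; split.
    { intros t; eapply is_derive_continuous, Hu. }
    intros t Ht.
    assert (0 <= u t).
    { destruct (MVT_gen u 0 t (fun s => sqrt (F (Rmax (u s) 0))))
        as [c [_ E]].
      - intros; apply Hu.
      - intros s _; apply continuity_pt_filterlim.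
        eapply is_derive_continuous, Hu.
      - pose proof (sqrt_pos (F (Rmax (u c) 0))); nra. }
    pose proof (Hu t) as Hd; rewrite Rmax_left in Hd by assumption.
    pose proof (expansion_rate_pos (u t)) as Hp.
    split; [|split; [|split]].
    + now apply sqrt_lt_R0.
    + now apply pow2_sqrt, Rlt_le.
    + exact Hd.
    + now apply expansion_rate_derive.
Qed.

End Expansion.

(** * Assembly of the solution from [u] and [J] *)

Theorem theorem5p2
  (Lambda a0 da0 b0 db0 phi0 dphi0 rho0 : R)
  (ha0 : 0 < a0) (hb0 : 0 < b0) (hdphi0 : 0 < dphi0) (hrho0 : 0 <= rho0)
  (hconstraint : hamiltonian_constraint Lambda a0 da0 b0 db0 dphi0 rho0)
  (hLambda : 0 <= Lambda) (hdb0 : 0 < db0) :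
  exists a b rho phi : R -> R,
    is_global_solution Lambda a0 da0 b0 db0 phi0 dphi0 rho0 a b rho phi.
Proof.
  unfold hamiltonian_constraint in hconstraint.
  pose proof PI_RGT_0 as Hpi.
  set (H0 := da0 / a0) in *; set (K0 := db0 / b0) in *.
  (* [s0] is the initial shear. With [H = q + 2 s] and [K = q - s] one has
     [K^2 + 2 H K = 3 q^2 - 3 s^2]; solving the constraint for [q^2] gives the coefficients [L],
     [r], [m]. *)
  pose (s0 := (H0 - K0) / 3).
  pose (L := Lambda / 3); pose (r := 8 * PI * rho0 / 3).
  pose (m := (4 * PI * dphi0 ^ 2 + 3 * s0 ^ 2) / 3).
  assert (HL : 0 <= L) by (unfold L; lra).
  assert (Hr : 0 <= r) by (unfold r; nra).
  assert (Hpd : 0 < PI * dphi0 ^ 2) by (apply Rmult_lt_0_compat; nra).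
  assert (Hm : 0 < m) by (unfold m; nra).
  destruct (expansion_global L r m HL Hr Hm) as [u [q [Hu0 [Huc Hu]]]].
  assert (Hq0 : q 0 = (H0 + 2 * K0) / 3).
  { destruct (Hu 0 (Rle_refl 0)) as [Hq [Hq2 _]].
    rewrite Hu0, !Rmult_0_r, exp_0 in Hq2.
    assert (HK : 0 < K0) by (now apply Rdiv_lt_0_compat).
    assert (0 <= PI * rho0) by nra.
    (* The constraint makes [K0 * (K0 + 2 * H0)] positive, so [K0 + 2 * H0 > 0]; adding [3 * K0]
       gives twice the claim. This fixes the sign when [q 0] is recovered from its square. *)
    assert (Hpos : 0 < H0 + 2 * K0) by nra.
    assert (q 0 ^ 2 = ((H0 + 2 * K0) / 3) ^ 2).
    { rewrite Hq2; unfold L, r, m, s0; lra. }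
    nra. }
  pose (J := fun t => RInt (fun s => exp (-3 * u s)) 0 t).
  assert (HJ0 : J 0 = 0) by exact (RInt_point 0 _).
  assert (HJ : forall t, is_derive J t (exp (-3 * u t))).
  { assert (Hce : forall t, continuous (fun s => exp (-3 * u s)) t).
    { intros t; apply (continuous_comp u (fun x => exp (-3 * x))); [apply Huc|].
      apply (ex_derive_continuous (V := R_NormedModule)); auto_derive; auto. }
    intros t; now apply (is_derive_primitive (fun s => exp (-3 * u s))). }
  (* Since [s = s0 * J'], the logarithms of [a] and [b] below have derivatives [q + 2 s] and
     [q - s]. *)
  pose (s := fun t => s0 * exp (-3 * u t)).
  pose (a := fun t => a0 * exp (u t + 2 * s0 * J t)).
  pose (b := fun t => b0 * exp (u t - s0 * J t)).
  pose (rho := fun t => rho0 * exp (-4 * u t)).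
  pose (dphi := fun t => dphi0 * exp (-3 * u t)).
  pose (dq := fun t => - (2 * r * exp (-4 * u t) + 3 * m * exp (-6 * u t))).
  (* [H] and [K] are the directional Hubble rates [a'/a] and [b'/b], with [H + 2 K = 3 q]. Their
     derivatives [dH] and [dK] use [s' = -3 q s]. *)
  pose (H := fun t => q t + 2 * s t).
  pose (K := fun t => q t - s t).
  pose (dH := fun t => dq t - 6 * q t * s t).
  pose (dK := fun t => dq t + 3 * q t * s t).
  assert (Hdexp : forall c k t, 0 <= t ->
    is_derive (fun x => c * exp (k * u x)) t (k * q t * (c * exp (k * u t)))).
  { intros c k t Ht; apply (is_derive_scal_exp c (fun x => k * u x)).
    apply (is_derive_scal u), Hu, Ht. }
  assert (Hds : forall t, 0 <= t -> is_derive s t (-3 * q t * s t)).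
  { intros t Ht; now apply Hdexp. }
  assert (Hda : forall t, 0 <= t -> is_derive a t (H t * a t)).
  { intros t Ht; apply (is_derive_scal_exp a0 (fun x => u x + 2 * s0 * J x)); evar_last.
    - apply (is_derive_plus u (fun x => 2 * s0 * J x)); [apply Hu, Ht|].
      apply is_derive_scal, HJ.
    - unfold H, s, plus; simpl; ring. }
  assert (Hdb : forall t, 0 <= t -> is_derive b t (K t * b t)).
  { intros t Ht; apply (is_derive_scal_exp b0 (fun x => u x - s0 * J x)); evar_last.
    - apply (is_derive_minus u (fun x => s0 * J x)); [apply Hu, Ht|].
      apply is_derive_scal, HJ.
    - unfold K, s, minus, plus, opp; simpl; ring. }
  assert (HdH : forall t, 0 <= t -> is_derive H t (dH t)).
  { intros t Ht; evar_last.
    - apply (is_derive_plus q (fun x => 2 * s x)); [apply Hu, Ht|].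
      apply is_derive_scal, Hds, Ht.
    - unfold dH, dq, plus; simpl; ring. }
  assert (HdK : forall t, 0 <= t -> is_derive K t (dK t)).
  { intros t Ht; evar_last.
    - apply (is_derive_minus q s); [apply Hu, Ht | apply Hds, Ht].
    - unfold dK, dq, minus, plus, opp; simpl; ring. }
  assert (Hmul : forall f g df dg t, is_derive f t df -> is_derive g t dg ->
    is_derive (fun x => f x * g x) t (df * g t + f t * dg)).
  { intros f g df dg t Hf Hg.
    apply (is_derive_mult f g t df dg Hf Hg Rmult_comm). }
  assert (Hex : forall t, 0 <= t -> ex_derive u t /\ ex_derive q t /\ ex_derive J t).
  { intros t Ht; destruct (Hu t Ht) as [_ [_ [Hut Hqt]]].
    split; [|split]; eexists; eauto. }
  exists a, b, rho, (fun t => phi0 + dphi0 * J t).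
  split; [exact I|].
  (* Second derivatives come from [(H a)' = (H' + H^2) a], and likewise for [b]. *)
  exists (fun t => H t * a t), (fun t => (dH t + H t ^ 2) * a t),
    (fun t => K t * b t), (fun t => (dK t + K t ^ 2) * b t),
    dphi, (fun t => -3 * q t * dphi t), (fun t => -4 * q t * rho t).
  assert (Hcont : forall f t, ex_derive f t -> continuous f t)
    by (intros f t; apply (ex_derive_continuous (V := R_NormedModule))).
  split; [|split; [|split; [|split; [|split; [|split]]]]].
  - apply is_derive_C2_on; intros t [Ht _].
    + now apply Hda.
    + evar_last; [apply (Hmul H a); [apply HdH | apply Hda]; exact Ht|].
      simpl; ring.
    + apply Hcont; destruct (Hex t Ht) as [? [? ?]].
      unfold dH, H, dq, s, a; auto_derive; auto 12.
  - apply is_derive_C2_on; intros t [Ht _].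
    + now apply Hdb.
    + evar_last; [apply (Hmul K b); [apply HdK | apply Hdb]; exact Ht|].
      simpl; ring.
    + apply Hcont; destruct (Hex t Ht) as [? [? ?]].
      unfold dK, K, dq, s, b; auto_derive; auto 12.
  - apply is_derive_C2_on; intros t [Ht _].
    + evar_last.
      * apply (is_derive_plus (fun _ => phi0) (fun x => dphi0 * J x));
          [apply is_derive_const | apply is_derive_scal, HJ].
      * unfold dphi, plus, zero; simpl; ring.
    + now apply Hdexp.
    + apply Hcont; destruct (Hex t Ht) as [? [? ?]].
      unfold dphi; auto_derive; auto 12.
  - apply is_derive_C1_on; intros t [Ht _].
    + now apply Hdexp.
    + apply Hcont; destruct (Hex t Ht) as [? [? ?]].
      unfold rho; auto_derive; auto 12.
  - intros t _; unfold a, b, rho, dphi; repeat split;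
      [| | apply Rmult_le_pos; [lra | left; apply exp_pos] | left];
      apply Rmult_lt_0_compat; auto using exp_pos.
  - intros t [Ht _]; destruct (Hu t Ht) as [_ [Hq2 _]].
    assert (Ha : 0 < a t) by (apply Rmult_lt_0_compat; auto using exp_pos).
    assert (Hb : 0 < b t) by (apply Rmult_lt_0_compat; auto using exp_pos).
    (* This square lets the [m] term split into the contributions of [dphi^2] and [s^2]. *)
    assert (HE : exp (-6 * u t) = exp (-3 * u t) ^ 2).
    { simpl; rewrite Rmult_1_r, <- exp_plus; f_equal; ring. }
    (* The Friedmann equation with shear, equivalent to the Hamiltonian constraint; [Hray] below is
       the matching Raychaudhuri equation. *)
    assert (Hfried : 3 * q t ^ 2 = Lambda + 8 * PI * rho t
                       + 4 * PI * dphi t ^ 2 + 3 * s t ^ 2).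
    { rewrite Hq2, HE; unfold rho, dphi, s, L, r, m; field. }
    assert (Hray : dq t = - (16 / 3 * PI * rho t
                       + 4 * PI * dphi t ^ 2 + 3 * s t ^ 2)).
    { unfold dq; rewrite HE; unfold rho, dphi, s, r, m; field. }
    unfold hamiltonian_constraint, evolution_equations.
    replace (H t * a t / a t) with (H t) by (field; lra).
    replace (K t * b t / b t) with (K t) by (field; lra).
    replace ((dH t + H t ^ 2) * a t / a t) with (dH t + H t ^ 2) by (field; lra).
    replace ((dK t + K t ^ 2) * b t / b t) with (dK t + K t ^ 2) by (field; lra).
    replace (H t * a t * (K t * b t) / (a t * b t)) with (H t * K t)
      by (field; lra).
    (* The left sides of both spatial equations reduce to [2 q' + 3 q^2 + 3 s^2 - Lambda], which
       [Hray] and [Hfried] evaluate. The two matter equations follow from [H + 2 K = 3 q]. *)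
    unfold dH, dK; rewrite Hray; unfold H, K; repeat split; lra.
  (* At time 0 every exponential equals 1, and [q 0 + 2 * s0 = H0], [q 0 - s0 = K0]. *)
  - repeat split.
    + unfold a; rewrite Hu0, HJ0; replace (0 + 2 * s0 * 0) with 0 by ring.
      rewrite exp_0; ring.
    + unfold H, a, s; rewrite Hu0, HJ0, Hq0.
      replace (0 + 2 * s0 * 0) with 0 by ring.
      rewrite Rmult_0_r, exp_0; unfold s0, H0; field; lra.
    + unfold b; rewrite Hu0, HJ0; replace (0 - s0 * 0) with 0 by ring.
      rewrite exp_0; ring.
    + unfold K, b, s; rewrite Hu0, HJ0, Hq0.
      replace (0 - s0 * 0) with 0 by ring.
      rewrite Rmult_0_r, exp_0; unfold s0, K0; field; lra.
    + rewrite HJ0; ring.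
    + unfold dphi; rewrite Hu0, Rmult_0_r, exp_0; ring.
    + unfold rho; rewrite Hu0, Rmult_0_r, exp_0; ring.
Qed.
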